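(* Let $\mathfrak g$ be a Lie superalgebra over $\mathbb C$. Then $$\operatorname{H}^1(\mathfrak g,\mathbb C)\cong(\mathfrak g/[\mathfrak g,\mathfrak g])^*.$$
   Context: A Lie superalgebra is a $\mathbb Z_2$-graded space $\mathfrak g=\mathfrak g_{\bar0}\oplus\mathfrak g_{\bar1}$ with a bilinear bracket satisfying $[\mathfrak g_i,\mathfrak g_j]\subseteq\mathfrak g_{i+j}$, $[a,b]=-(-1)^{|a||b|}[b,a]$ and $[a,[b,c]]=[[a,b],c]+(-1)^{|a||b|}[b,[a,c]]$ for homogeneous elements. $\mathbb C$ denotes the one-dimensional trivial $\mathfrak g$-module concentrated in even degree. $[\mathfrak g,\mathfrak g]$ is the span of all brackets. $\operatorname{H}^\bullet(\mathfrak g,M)$ is the cohomology of the complex $C^p(\mathfrak g,M)=\operatorname{Hom}(\Lambda^p_s(\mathfrak g),M)$, where $\Lambda_s^p(\mathfrak g)=\bigoplus_{i+j=p}\Lambda^i(\mathfrak g_{\bar0})\otimes S^j(\mathfrak g_{\bar1})$, with differential, for homogeneous $f$, $$df(\omega_0\wedge\cdots\wedge\omega_p)=\sum_{i}(-1)^{\tau_i}\omega_i\cdot f(\omega_0\wedge\cdots\widehat{\omega_i}\cdots\wedge\omega_p)+\sum_{i<j}(-1)^{\sigma_{i,j}}f([\omega_i,\omega_j]\wedge\omega_0\wedge\cdots\widehat{\omega_i}\cdots\widehat{\omega_j}\cdots\wedge\omega_p),$$ $\tau_i=i+|\omega_i|(|\omega_0|+\cdots+|\omega_{i-1}|+|f|)$,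 $\sigma_{i,j}=i+j+|\omega_i||\omega_j|+|\omega_i|(|\omega_0|+\cdots+|\omega_{i-1}|)+|\omega_j|(|\omega_0|+\cdots+|\omega_{j-1}|)$, extended linearly. *)

(* Defs.v *)
From HB Require Import structures.
From mathcomp Require Import all_boot all_order all_algebra all_fingroup.
From mathcomp Require Import boolp classical_sets functions reals.
From mathcomp Require Import complex generic_quotient ring_quotient freeg.

Set Implicit Arguments.
Unset Strict Implicit.
Unset Printing Implicit Defensive.

Import GRing.Theory.

Local Open Scope ring_scope.
Local Open Scope classical_set_scope.
Local Open Scope quotient_scope.

Section LinearMaps.
Variables (K : fieldType) (U V : lmodType K).

(* The space Hom(U, V), for U and V of arbitrary dimension. *)
Definition is_linear_map : {pred U -> V} := fun f => `[< linear f >].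

Fact is_linear_map_closed : GRing.submod_closed is_linear_map.
Proof.
split.
  apply/asboolP => a x y; have E z : (0 : U -> V) z = 0 by [].
  by rewrite !E scaler0 addr0.
move=> c f h /asboolP fl /asboolP hl; apply/asboolP => a x y.
have E z : (c *: f + h : U -> V) z = c *: f z + h z by [].
by rewrite !E fl hl !scalerDr !scalerA [c * a]mulrC addrACA.
Qed.

HB.instance Definition _ :=
  GRing.isSubmodClosed.Build K (U -> V) is_linear_map is_linear_map_closed.

Record linmap := LinMap {
  linmap_fun :> U -> V;
  linmap_funP : linmap_fun \in is_linear_map }.

HB.instance Definition _ := [isSub for linmap_fun].
HB.instance Definition _ := [Choice of linmap by <:].
HB.instance Definition _ := [SubChoice_isSubLmodule of linmap by <:].

Fact linmap_linear (f : linmap) : linear f.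
Proof. by apply/asboolP; exact: linmap_funP f. Qed.

HB.instance Definition _ (f : linmap) :=
  GRing.isLinear.Build K U V *:%R (linmap_fun f) (linmap_linear f).

End LinearMaps.

Section Quotients.
Variables (K : fieldType) (V : lmodType K) (S : set V).

Definition span : {pred V} := fun v =>
  `[< exists s : seq (K * V),
        (forall c, c \in s -> S c.2) /\ v = \sum_(c <- s) c.1 *: c.2 >].

Fact span_closed : GRing.submod_closed span.
Proof.
split; first by apply/asboolP; exists [::]; rewrite big_nil.
move=> a _ _ /asboolP[s [Ss ->]] /asboolP[t [St ->]]; apply/asboolP.
exists ([seq (a * c.1, c.2) | c <- s] ++ t); split=> [c|].
  by rewrite mem_cat => /orP[/mapP[d /Ss Sd ->]|/St].
rewrite big_cat big_map scaler_sumr; congr (_ + _).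
by apply: eq_bigr => c _; rewrite scalerA.
Qed.

HB.instance Definition _ := GRing.isSubmodClosed.Build K V span span_closed.

(* V / span S *)
Definition lquot : Type := Quotient.quot span.

HB.instance Definition _ := GRing.Zmodule.on lquot.

Definition lquot_pi (v : V) : lquot := \pi_(Quotient.quot span) v.

Definition lquot_scale (a : K) (x : lquot) : lquot :=
  lquot_pi (a *: repr (x : Quotient.quot span)).

Fact lquot_piE (u v : V) : u - v \in span -> lquot_pi u = lquot_pi v.
Proof. by move=> uv; apply/eqmodP; rewrite /= Quotient.equivE. Qed.

Fact lquot_repr (v : V) : repr (lquot_pi v : Quotient.quot span) - v \in span.
Proof.
have /eqmodP : \pi_(Quotient.quot span) (repr (lquot_pi v : Quotient.quot span)) =
  \pi_(Quotient.quot span) v by rewrite reprK.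
by rewrite /= Quotient.equivE.
Qed.

Fact lquot_scale_pi a v : lquot_scale a (lquot_pi v) = lquot_pi (a *: v).
Proof. by apply: lquot_piE; rewrite -scalerBr rpredZ // lquot_repr. Qed.

Fact lquot_piD u v : lquot_pi (u + v) = lquot_pi u + lquot_pi v.
Proof. exact: (raddfD (\pi_(Quotient.quot span))). Qed.

Fact lquot_piW (P : lquot -> Prop) : (forall v, P (lquot_pi v)) -> forall x, P x.
Proof. by move=> Ppi x; rewrite -[x](reprK (x : Quotient.quot span)); exact: Ppi. Qed.

Fact lquot_scaleA a b x :
  lquot_scale a (lquot_scale b x) = lquot_scale (a * b) x.
Proof.
by elim/lquot_piW: x => v; rewrite !lquot_scale_pi scalerA.
Qed.

Fact lquot_scale1 : left_id 1 lquot_scale.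
Proof. by elim/lquot_piW=> v; rewrite lquot_scale_pi scale1r. Qed.

Fact lquot_scaleDr : right_distributive lquot_scale +%R.
Proof.
move=> a; elim/lquot_piW=> u; elim/lquot_piW=> v.
by rewrite -lquot_piD !lquot_scale_pi scalerDr lquot_piD.
Qed.

Fact lquot_scaleDl x : {morph lquot_scale^~ x : a b / a + b}.
Proof.
by elim/lquot_piW: x => v a b; rewrite !lquot_scale_pi scalerDl lquot_piD.
Qed.

HB.instance Definition _ := GRing.Zmodule_isLmodule.Build K lquot
  lquot_scaleA lquot_scale1 lquot_scaleDr lquot_scaleDl.

Fact lquot_pi_linear : linear lquot_pi.
Proof. by move=> a u v; rewrite lquot_piD -lquot_scale_pi. Qed.

HB.instance Definition _ :=
  GRing.isLinear.Build K V lquot *:%R lquot_pi lquot_pi_linear.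

End Quotients.

Section DirectSums.
Variables (K : fieldType) (n : nat) (T : 'I_n -> lmodType K).

(* The index set is finite, so the direct sum is the product. *)
Definition dsum : Type := forall i, T i.

HB.instance Definition _ := gen_eqMixin dsum.
HB.instance Definition _ := gen_choiceMixin dsum.

Implicit Types x y z : dsum.

Definition dsum_zero : dsum := fun=> 0.
Definition dsum_opp x : dsum := fun i => - x i.
Definition dsum_add x y : dsum := fun i => x i + y i.
Definition dsum_scale a x : dsum := fun i => a *: x i.

Fact dsum_addA : associative dsum_add.
Proof. by move=> x y z; apply: functional_extensionality_dep => i; exact: addrA. Qed.
Fact dsum_addC : commutative dsum_add.
Proof. by move=> x y; apply: functional_extensionality_dep => i; exact: addrC. Qed.
Fact dsum_add0 : left_id dsum_zero dsum_add.
Proof. by move=> x; apply: functional_extensionality_dep => i; exact: add0r. Qed.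
Fact dsum_addN : left_inverse dsum_zero dsum_opp dsum_add.
Proof. by move=> x; apply: functional_extensionality_dep => i; exact: addNr. Qed.

HB.instance Definition _ :=
  GRing.isZmodule.Build dsum dsum_addA dsum_addC dsum_add0 dsum_addN.

Fact dsum_scaleA a b x : dsum_scale a (dsum_scale b x) = dsum_scale (a * b) x.
Proof. by apply: functional_extensionality_dep => i; exact: scalerA. Qed.
Fact dsum_scale1 : left_id 1 dsum_scale.
Proof. by move=> x; apply: functional_extensionality_dep => i; exact: scale1r. Qed.
Fact dsum_scaleDr : right_distributive dsum_scale +%R.
Proof.
by move=> a x y; apply: functional_extensionality_dep => i; exact: scalerDr.
Qed.
Fact dsum_scaleDl x : {morph dsum_scale^~ x : a b / a + b}.
Proof.
by move=> a b; apply: functional_extensionality_dep => i; exact: scalerDl.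
Qed.

HB.instance Definition _ := GRing.Zmodule_isLmodule.Build K dsum
  dsum_scaleA dsum_scale1 dsum_scaleDr dsum_scaleDl.

End DirectSums.

Section TensorProduct.
Variables (K : fieldType) (U W : lmodType K).

Notation gen u w := (<< (u, w) >> : {freeg (U * W)%type / K}).

Definition bilinear_rel : set {freeg (U * W)%type / K} :=
  [set r | (exists a u u' w,
             r = gen (a *: u + u') w - (a *: gen u w + gen u' w)) \/
           (exists a u w w',
             r = gen u (a *: w + w') - (a *: gen u w + gen u w'))].

Definition tensor : lmodType K := lquot bilinear_rel.

Definition tens (u : U) (w : W) : tensor := lquot_pi bilinear_rel (gen u w).

End TensorProduct.

Section Powers.
Variables (K : fieldType) (V : lmodType K) (n : nat).

Notation gen t := (<< t >> : {freeg (n.-tuple V) / K}).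

Definition subst_at (t : n.-tuple V) (i : 'I_n) (x : V) : n.-tuple V :=
  [tuple if k == i then x else tnth t k | k < n].

Definition multilinear_rel : set {freeg (n.-tuple V) / K} :=
  [set r | exists t i a x y,
     r = gen (subst_at t i (a *: x + y)) -
         (a *: gen (subst_at t i x) + gen (subst_at t i y))].

Definition alternating_rel : set {freeg (n.-tuple V) / K} :=
  [set r | exists t i j, [/\ i != j, tnth t i = tnth t j & r = gen t]].

Definition symmetric_rel : set {freeg (n.-tuple V) / K} :=
  [set r | exists t (s : 'S_n), r = gen t - gen [tuple tnth t (s k) | k < n]].

Definition ext_power : lmodType K := lquot (multilinear_rel `|` alternating_rel).
Definition sym_power : lmodType K := lquot (multilinear_rel `|` symmetric_rel).

(* Products of lists; a list whose length is not n is sent to 0. *)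
Definition ext_prod (s : seq V) : ext_power :=
  if insub s is Some t then lquot_pi _ (gen t) else 0.
Definition sym_prod (s : seq V) : sym_power :=
  if insub s is Some t then lquot_pi _ (gen t) else 0.

End Powers.

Record superspace (K : fieldType) := Superspace {
  even_part : lmodType K;
  odd_part : lmodType K }.

Definition total (K : fieldType) (V : superspace K) : lmodType K :=
  (even_part V * odd_part V)%type.
Coercion total : superspace >-> lmodType.

(* A homogeneous element together with its parity (true for odd). *)
Definition homog (K : fieldType) (V : superspace K) : Type :=
  (even_part V + odd_part V)%type.

Section Homogeneous.
Variables (K : fieldType) (V : superspace K).

Definition parity (a : homog V) : bool := if a is inr _ then true else false.

Definition elt (a : homog V) : V :=
  match a with inl x => (x, 0) | inr x => (0, x) end.

Definition in_degree (e : bool) (v : V) : Prop := if e then v.1 = 0 else v.2 = 0.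

Definition component (e : bool) (v : V) : homog V :=
  if e then inr v.2 else inl v.1.

Definition evens (w : seq (homog V)) : seq (even_part V) :=
  pmap (fun a => if a is inl x then Some x else None) w.
Definition odds (w : seq (homog V)) : seq (odd_part V) :=
  pmap (fun a => if a is inr x then Some x else None) w.

(* Number of pairs of positions k < l with an odd entry at k, an even one at l. *)
Fixpoint crossings (w : seq (homog V)) : nat :=
  if w is a :: w' then (parity a * size (evens w') + crossings w')%N else 0%N.

(* The direct sum over i + j = p of Lambda^i(V_0) (x) S^j(V_1). *)
Definition super_ext (p : nat) : lmodType K :=
  @dsum K p.+1 (fun i => tensor (ext_power (even_part V) i)
                                (sym_power (odd_part V) (p - i))).

(* The element w_1 /\ ... /\ w_p of the super exterior power. The even factors
   are moved to the left of the odd ones by a /\ b = - (-1)^(|a||b|) b /\ a, so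
   each crossing contributes a factor -1. Only the summand whose index is the
   number of even factors is nonzero. *)
Definition wedge (p : nat) (w : seq (homog V)) : super_ext p :=
  fun i => (-1) ^+ crossings w *: tens (ext_prod i (evens w))
                                       (sym_prod (p - i) (odds w)).

End Homogeneous.

Arguments wedge {K V} p w.

(* The usual notion when K has characteristic 0; in characteristic 2 or 3 further
   axioms would be needed. *)
Record lieSuperalgebra (K : fieldType) := LieSuperalgebra {
  lsa_space :> superspace K;
  bracket : lsa_space -> lsa_space -> lsa_space;
  bracket_linearl : forall y, linear (bracket^~ y);
  bracket_linearr : forall x, linear (bracket x);
  bracket_degree : forall a b : homog lsa_space,
    in_degree (parity a (+) parity b) (bracket (elt a) (elt b));
  bracket_anticomm : forall a b : homog lsa_space,
    bracket (elt a) (elt b) =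
      - ((-1) ^+ (parity a * parity b) *: bracket (elt b) (elt a));
  bracket_jacobi : forall a b c : homog lsa_space,
    bracket (elt a) (bracket (elt b) (elt c)) =
      bracket (bracket (elt a) (elt b)) (elt c) +
      (-1) ^+ (parity a * parity b) *:
        bracket (elt b) (bracket (elt a) (elt c)) }.

Record supermodule (K : fieldType) (g : lieSuperalgebra K) := Supermodule {
  smod_space :> superspace K;
  act : g -> smod_space -> smod_space;
  act_linearl : forall m, linear (act^~ m);
  act_linearr : forall x, linear (act x);
  act_degree : forall (a : homog g) (m : homog smod_space),
    in_degree (parity a (+) parity m) (act (elt a) (elt m));
  act_bracket : forall (a b : homog g) (m : smod_space),
    act (bracket (elt a) (elt b)) m =
      act (elt a) (act (elt b) m) -
      (-1) ^+ (parity a * parity b) *: act (elt b) (act (elt a) m) }.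

Section TrivialModule.
Variables (K : fieldType) (g : lieSuperalgebra K).

Definition trivial_space : superspace K := Superspace K^o 'rV[K]_0.

Definition trivial_act (x : g) (m : trivial_space) : trivial_space := 0.

Fact trivial_act_linearl m : linear (trivial_act^~ m).
Proof. by move=> a x y; rewrite /trivial_act scaler0 addr0. Qed.
Fact trivial_act_linearr x : linear (trivial_act x).
Proof. by move=> a m n; rewrite /trivial_act scaler0 addr0. Qed.
Fact trivial_act_degree (a : homog g) (m : homog trivial_space) :
  in_degree (parity a (+) parity m) (trivial_act (elt a) (elt m)).
Proof. by case: (_ (+) _). Qed.
Fact trivial_act_bracket (a b : homog g) (m : trivial_space) :
  trivial_act (bracket (elt a) (elt b)) m =
    trivial_act (elt a) (trivial_act (elt b) m) -
    (-1) ^+ (parity a * parity b) *: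
      trivial_act (elt b) (trivial_act (elt a) m).
Proof. by rewrite /trivial_act scaler0 subr0. Qed.

Definition trivial_module : supermodule g :=
  Supermodule trivial_act_linearl trivial_act_linearr
              trivial_act_degree trivial_act_bracket.

End TrivialModule.

Section Cohomology.
Variables (K : fieldType) (g : lieSuperalgebra K) (M : supermodule g).

Definition cochain (p : nat) : lmodType K := linmap (super_ext g p) M.

Definition hbracket (a b : homog g) : homog g :=
  component (parity a (+) parity b) (bracket (elt a) (elt b)).

Section Differential.
Variable p : nat.
Implicit Types (f : cochain p) (w : p.+1.-tuple (homog g)).

(* Wedges of homogeneous elements span, so it is enough to test on them. *)
Definition cochain_degree (q : nat) (e : bool) (f : cochain q) : Prop :=
  forall w : q.-tuple (homog g),
    in_degree (e (+) odd (\sum_(k < q) parity (tnth w k))%N) (f (wedge q w)).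

Definition omit w (s : seq 'I_p.+1) : seq (homog g) :=
  [seq tnth w k | k <- enum 'I_p.+1 & k \notin s].

Definition parity_before w (i : 'I_p.+1) : nat :=
  (\sum_(k < p.+1 | k < i) parity (tnth w k))%N.

Definition tau (e : bool) w (i : 'I_p.+1) : nat :=
  (i + parity (tnth w i) * (parity_before w i + e))%N.

Definition sigma w (i j : 'I_p.+1) : nat :=
  (i + j + parity (tnth w i) * parity (tnth w j)
     + parity (tnth w i) * parity_before w i
     + parity (tnth w j) * parity_before w j)%N.

(* The value of df on w_0 /\ ... /\ w_p, for f homogeneous of parity e. *)
Definition d_formula (e : bool) f w : M :=
  \sum_(i < p.+1)
     (-1) ^+ tau e w i *: act (elt (tnth w i)) (f (wedge p (omit w [:: i])))
  + \sum_(i < p.+1) \sum_(j < p.+1 | (i < j)%N)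
     (-1) ^+ sigma w i j *:
       f (wedge p (hbracket (tnth w i) (tnth w j) :: omit w [:: i; j])).

(* "df = h". The formula determines h because the wedges of homogeneous
   elements span; f is split into its even and odd parts. *)
Definition is_d f (h : cochain p.+1) : Prop :=
  exists f0 f1 : cochain p,
    [/\ cochain_degree false f0, cochain_degree true f1, f = f0 + f1 &
        forall w, h (wedge p.+1 w) = d_formula false f0 w + d_formula true f1 w].

Fact d_formula_linear e w : linear (fun f => d_formula e f w).
Proof.
move=> a f h; rewrite /d_formula.
have lE x : (a *: f + h) x = a *: f x + h x by [].
rewrite scalerDr addrACA; congr (_ + _); rewrite scaler_sumr -big_split.
  apply: eq_bigr => i _.
  by rewrite lE act_linearr scalerDr !scalerA mulrC.
apply: eq_bigr => i _; rewrite scaler_sumr -big_split.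
by apply: eq_bigr => j _; rewrite lE scalerDr !scalerA mulrC.
Qed.

Fact cochain_degree_linear e a f h :
  cochain_degree e f -> cochain_degree e h -> cochain_degree e (a *: f + h).
Proof.
move=> fe he w; move: (fe w) (he w); rewrite /in_degree.
case: ifP => _ f0 h0.
  by rewrite -[LHS]/(a *: (f (wedge p w)).1 + (h (wedge p w)).1) f0 h0 scaler0 addr0.
by rewrite -[LHS]/(a *: (f (wedge p w)).2 + (h (wedge p w)).2) f0 h0 scaler0 addr0.
Qed.

Fact cochain_degree0 e : cochain_degree e (0 : cochain p).
Proof. by move=> w; rewrite /in_degree; case: ifP. Qed.

Definition is_cocycle : {pred cochain p} := fun f => `[< is_d f 0 >].

Fact is_cocycle_closed : GRing.submod_closed is_cocycle.
Proof.
split.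
  apply/asboolP; exists 0, 0; split; rewrite ?addr0//; try exact: cochain_degree0.
  move=> w; have d0 e : d_formula e 0 w = 0.
    have /eqP := d_formula_linear e w 1 0 0.
    by rewrite !scale1r addr0 eq_sym -subr_eq0 addrK => /eqP.
  by rewrite !d0 addr0.
move=> a f h /asboolP[f0 [f1 [? ? -> df]]] /asboolP[h0 [h1 [? ? -> dh]]].
apply/asboolP; exists (a *: f0 + h0), (a *: f1 + h1).
split; try exact: cochain_degree_linear.
  by rewrite scalerDr addrACA.
move=> w; rewrite !d_formula_linear addrACA -scalerDr -df -dh.
have E : (0 : cochain p.+1) (wedge p.+1 w) = 0 by [].
by rewrite !E scaler0 addr0.
Qed.

HB.instance Definition _ :=
  GRing.isSubmodClosed.Build K (cochain p) is_cocycle is_cocycle_closed.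

Record cocycle := Cocycle {
  cocycle_val :> cochain p;
  cocycle_valP : cocycle_val \in is_cocycle }.

HB.instance Definition _ := [isSub for cocycle_val].
HB.instance Definition _ := [Choice of cocycle by <:].
HB.instance Definition _ := [SubChoice_isSubLmodule of cocycle by <:].

End Differential.

(* im d meets ker d; as d o d = 0 this is all of im d. *)
Definition coboundaries (p : nat) : set (cocycle p) :=
  match p with
  | 0 => set0
  | q.+1 => [set z | exists h : cochain q, is_d h (cocycle_val z)]
  end.

Definition cohomology (p : nat) : lmodType K := lquot (@coboundaries p).

(* The classes of homogeneous cocycles of parity e. *)
Definition cohomology_degree (p : nat) (e : bool) (c : cohomology p) : Prop :=
  exists z : cocycle p,
    cochain_degree e (cocycle_val z) /\ c = lquot_pi (@coboundaries p) z.

End Cohomology.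

Section Abelianization.
Variables (K : fieldType) (g : lieSuperalgebra K).

Definition brackets : set g := [set z | exists x y, z = bracket x y].

Definition abelianization : lmodType K := lquot brackets.

Definition abelianization_dual : lmodType K := linmap abelianization K^o.

(* As K is purely even, a functional of parity e kills the other parity. *)
Definition dual_degree (e : bool) (psi : abelianization_dual) : Prop :=
  forall a : homog g, parity a != e -> psi (lquot_pi brackets (elt a)) = 0.

End Abelianization.

(* Main.v *)
(* In degree 1 the super exterior power is g itself, so a 1-cochain with trivial
   coefficients is a functional on g. Its differential is, up to sign, its value
   on brackets, so the 1-cocycles are the functionals killing [g, g]; and the
   differential of a 0-cochain vanishes because the action is trivial. *)

Require Import Defs.
From HB Require Import structures.
From mathcomp Require Import all_boot all_order all_algebra all_fingroup.
From mathcomp Require Import boolp classical_sets.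
From mathcomp Require Import reals complex generic_quotient ring_quotient freeg.

Set Implicit Arguments.
Unset Strict Implicit.
Unset Printing Implicit Defensive.

Import GRing.Theory.

Local Open Scope ring_scope.

(** * Linear maps out of quotients, free modules, tensor products and powers *)

Lemma linear_fun0 (K : nzRingType) (V W : lmodType K) (f : V -> W) :
  linear f -> f 0 = 0.
Proof. by move=> /(_ (-1) 0 0); rewrite !scaleN1r !addNr. Qed.

Lemma linear_funZ (K : nzRingType) (V W : lmodType K) (f : V -> W) a x :
  linear f -> f (a *: x) = a *: f x.
Proof. by move=> fl; rewrite -[a *: x]addr0 fl (linear_fun0 fl) addr0. Qed.

Section QuotientLift.
Variables (K : fieldType) (V W : lmodType K) (S : set V).

(** The lift applies [F] to the representative chosen by [repr]. The choice is harmless: two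
    representatives differ by a combination of elements of [S], on which [F] vanishes. *)
Lemma lquot_lift (F : {linear V -> W}) :
  (forall v, S v -> F v = 0) ->
  exists h : {linear lquot S -> W}, forall v, h (lquot_pi S v) = F v.
Proof.
move=> FS.
pose h (x : lquot S) : W := F (repr (x : Quotient.quot (Defs.span S))).
have hE v : h (lquot_pi S v) = F v.
  apply/eqP; rewrite -subr_eq0 -linearB /=.
  have /asboolP[s [Ss ->]] := lquot_repr S v.
  rewrite linear_sum big_seq big1// => c /Ss Sc.
  by rewrite linearZ/= FS// scaler0.
have hlin : linear h.
  move=> a; elim/lquot_piW => u; elim/lquot_piW => v.
  by rewrite -linearP !hE linearP.
pose hL := GRing.isLinear.Build K (lquot S) W *:%R h hlin.
by exists (HB.pack_for {linear lquot S -> W} h hL).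
Qed.

Lemma lquot_pi0 (v : V) : S v -> lquot_pi S v = 0.
Proof.
move=> Sv; rewrite -(linear0 (lquot_pi S)); apply: lquot_piE; rewrite subr0.
apply/asboolP; exists [:: (1, v)]; rewrite big_seq1 scale1r; split=> // c.
by rewrite inE => /eqP ->.
Qed.

End QuotientLift.

Section LinearMapTheory.
Variables (K : fieldType) (U V : lmodType K).

Definition linmap_of (f : U -> V) (fl : linear f) : linmap U V :=
  LinMap (introT (asboolP _) fl : f \in @is_linear_map K U V).

Lemma linmap_eq (f h : linmap U V) : f =1 h -> f = h.
Proof. by move=> fh; apply: val_inj; exact/funext. Qed.

End LinearMapTheory.


Section FreeModule.
Variables (K : fieldType) (T : choiceType) (W : lmodType K).

(** Additivity is [lift_is_additive]. Homogeneity comes from expanding [D] over its support, where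
    the scalar multiplies each coefficient. *)
Lemma fglift_linear (f : T -> W) : linear (fglift f : {freeg T / K} -> W).
Proof.
move=> a D D'.
pose fA := GRing.isZmodMorphism.Build _ _ (fglift f) (lift_is_additive f).
pose F : {additive {freeg T / K} -> W} :=
  HB.pack_for {additive {freeg T / K} -> W} (fglift f) fA.
rewrite [LHS](raddfD F); congr (_ + _).
rewrite -[in RHS](freeg_sumE D) [X in _ = _ *: X](raddf_sum F) scaler_sumr.
have -> : a *: D = \sum_(x <- dom D) << a * coeff x D *g x >> by [].
rewrite [LHS](raddf_sum F).
by apply: eq_bigr => x _; rewrite /= !liftU scalerA.
Qed.

Lemma freegUZ (c : K) (t : T) : << c *g t >> = c *: << t >> :> {freeg T / K}.
Proof.
by apply/eqP/freeg_eqP => x; rewrite coeffU [RHS]coeff_fgscale coeffU mul1r.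
Qed.

Variable S : set {freeg T / K}.

(** Universal property of the module with generators [T] and relators [S]. The tensor product and
    both kinds of powers are of this shape. *)
Lemma freeg_lquot_lift (f : T -> W) : (forall r, S r -> fglift f r = 0) ->
  exists h : {linear lquot S -> W}, forall t, h (lquot_pi S << t >>) = f t.
Proof.
pose fL := GRing.isLinear.Build K _ W *:%R (fglift f) (fglift_linear f).
pose F := HB.pack_for {linear {freeg T / K} -> W} (fglift f) fL.
move=> /(@lquot_lift K _ W S F)[h hE].
by exists h => t; rewrite hE/= liftU scale1r.
Qed.

Lemma freeg_lquot_ind (P : lquot S -> Prop) :
  P 0 -> (forall a x y, P x -> P y -> P (a *: x + y)) ->
  (forall t, P (lquot_pi S << t >>)) -> forall x, P x.
Proof.
move=> P0 PD PU; elim/lquot_piW => D.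
rewrite -(freeg_sumE D); elim: (dom D) => [|t s IH].
  by rewrite big_nil linear0.
by rewrite big_cons freegUZ linearP; apply: PD; [exact: PU|].
Qed.

End FreeModule.

Section TensorLift.
Variables (K : fieldType) (U W X : lmodType K).

Lemma tens_linearl (w : W) : linear (fun u : U => tens u w).
Proof.
move=> a u u'; rewrite /tens -linearP; apply: lquot_piE.
(* The difference of the two sides is itself a relator, so a one-term combination suffices. The
   equation, treated first, determines which relator it is. *)
apply/asboolP; eexists [:: (1, _)]; split; last first.
  by rewrite big_seq1 /= scale1r.
by move=> c; rewrite inE => /eqP ->; left; exists a, u, u', w.
Qed.

Lemma tens_linearr (u : U) : linear (fun w : W => tens u w).
Proof.
move=> a w w'; rewrite /tens -linearP; apply: lquot_piE.
apply/asboolP; eexists [:: (1, _)]; split; last first.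
  by rewrite big_seq1 /= scale1r.
by move=> c; rewrite inE => /eqP ->; right; exists a, u, w, w'.
Qed.

Lemma tensor_lift (B : U -> W -> X) :
  (forall w, linear (B^~ w)) -> (forall u, linear (B u)) ->
  exists h : {linear tensor U W -> X}, forall u w, h (tens u w) = B u w.
Proof.
move=> Bl Br.
have [|h hE] :=
  @freeg_lquot_lift K _ X (@bilinear_rel K U W) (fun p => B p.1 p.2).
  move=> r br.
  set F := fglift _.
  have FB x y : F (x - y) = F x - F y by rewrite /F lift_is_additive.
  have FL := fglift_linear (fun p : U * W => B p.1 p.2) : linear F.
  have FU u w : F << (u, w) >> = B u w by rewrite /F liftU scale1r.
  case: br => [[a [u [u' [w ->]]]]|[a [u [w [w' ->]]]]];
    by rewrite FB FL !FU /= ?Bl ?Br subrr.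
by exists h => u w; rewrite hE.
Qed.

End TensorLift.

Section PowerLift.
Variables (K : fieldType) (V W : lmodType K) (n : nat).

Definition multilinear (f : n.-tuple V -> W) := forall t i a x y,
  f (subst_at t i (a *: x + y)) = a *: f (subst_at t i x) + f (subst_at t i y).

Lemma fglift_multilinear_rel (f : n.-tuple V -> W) r :
  multilinear f -> @multilinear_rel K V n r -> fglift f r = 0.
Proof.
move=> fM [t [i [a [x [y ->]]]]].
by rewrite lift_is_additive (fglift_linear f) !liftU !scale1r fM subrr.
Qed.

Lemma ext_power_lift (f : n.-tuple V -> W) : multilinear f ->
    (forall t i j, i != j -> tnth t i = tnth t j -> f t = 0) ->
  exists h : {linear ext_power V n -> W},
    forall t : n.-tuple V, h (ext_prod n t) = f t.
Proof.
move=> fM fA.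
have [r [/(fglift_multilinear_rel fM)//|[t [i [j [ij tij ->]]]]]|h hE] :=
  @freeg_lquot_lift K _ W
    (@multilinear_rel K V n `|` @alternating_rel K V n)%classic f.
  by rewrite liftU (fA t i j)// scaler0.
by exists h => t; rewrite /ext_prod valK hE.
Qed.

Lemma sym_power_lift (f : n.-tuple V -> W) : multilinear f ->
    (forall t (s : 'S_n), f [tuple tnth t (s k) | k < n] = f t) ->
  exists h : {linear sym_power V n -> W},
    forall t : n.-tuple V, h (sym_prod n t) = f t.
Proof.
move=> fM fS.
have [r [/(fglift_multilinear_rel fM)//|[t [s ->]]]|h hE] :=
  @freeg_lquot_lift K _ W
    (@multilinear_rel K V n `|` @symmetric_rel K V n)%classic f.
  by rewrite lift_is_additive !liftU fS subrr.
by exists h => t; rewrite /sym_prod valK hE.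
Qed.

End PowerLift.

(** * Degree one *)

Section LowPowers.
Variables (K : fieldType) (V : lmodType K).

(** Nothing of [t] survives the substitution, so for tuples of length 1 multilinearity is plain
    linearity. *)
Lemma subst_at1 (t : 1.-tuple V) i x : subst_at t i x = [tuple x].
Proof.
by apply: eq_from_tnth => j; rewrite tnth_mktuple !ord1 eqxx.
Qed.

Lemma multilinear1 : multilinear (fun t : 1.-tuple V => tnth t ord0).
Proof. by move=> t i a x y; rewrite !subst_at1. Qed.

Lemma ext_prod1_linear : linear (fun x : V => ext_prod 1 [:: x]).
Proof.
move=> a x y.
(* The length test inside [ext_prod] succeeds on a one-element list. *)
have E z : ext_prod 1 [:: z] = lquot_pi _ << [tuple z] >>
  by rewrite /ext_prod (valK [tuple z]).
rewrite !E -linearP; apply: lquot_piE; apply/asboolP.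
eexists [:: (1, _)]; split; last by rewrite big_seq1 /= scale1r.
move=> c; rewrite inE => /eqP ->; left.
by exists [tuple x], ord0, a, x, y; rewrite !subst_at1.
Qed.

Lemma sym_prod1_linear : linear (fun x : V => sym_prod 1 [:: x]).
Proof.
move=> a x y.
have E z : sym_prod 1 [:: z] = lquot_pi _ << [tuple z] >>
  by rewrite /sym_prod (valK [tuple z]).
rewrite !E -linearP; apply: lquot_piE; apply/asboolP.
eexists [:: (1, _)]; split; last by rewrite big_seq1 /= scale1r.
move=> c; rewrite inE => /eqP ->; left.
by exists [tuple x], ord0, a, x, y; rewrite !subst_at1.
Qed.

(** Sums and multiples of products of length 1 are again such products, by linearity in the single
    factor. *)
Lemma ext_power1P (u : ext_power V 1) : exists x, u = ext_prod 1 [:: x].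
Proof.
elim/freeg_lquot_ind: u => [|a _ _ [x ->] [y ->]|t].
- by exists 0; rewrite (linear_fun0 ext_prod1_linear).
- by exists (a *: x + y); rewrite ext_prod1_linear.
- exists (tnth t ord0); rewrite /ext_prod.
  by case/tupleP: t => x t; rewrite [t]tuple0 (valK [tuple x]).
Qed.

Lemma sym_power1P (u : sym_power V 1) : exists x, u = sym_prod 1 [:: x].
Proof.
elim/freeg_lquot_ind: u => [|a _ _ [x ->] [y ->]|t].
- by exists 0; rewrite (linear_fun0 sym_prod1_linear).
- by exists (a *: x + y); rewrite sym_prod1_linear.
- exists (tnth t ord0); rewrite /sym_prod.
  by case/tupleP: t => x t; rewrite [t]tuple0 (valK [tuple x]).
Qed.

Lemma ext_power0P (u : ext_power V 0) : exists c, u = c *: ext_prod 0 [::].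
Proof.
elim/freeg_lquot_ind: u => [|a _ _ [c ->] [d ->]|t].
- by exists 0; rewrite scale0r.
- by exists (a * c + d); rewrite scalerDl scalerA.
- by exists 1; rewrite scale1r /ext_prod [t]tuple0 (valK [tuple]).
Qed.

Lemma sym_power0P (u : sym_power V 0) : exists c, u = c *: sym_prod 0 [::].
Proof.
elim/freeg_lquot_ind: u => [|a _ _ [c ->] [d ->]|t].
- by exists 0; rewrite scale0r.
- by exists (a * c + d); rewrite scalerDl scalerA.
- by exists 1; rewrite scale1r /sym_prod [t]tuple0 (valK [tuple]).
Qed.

(** Reading off the only entry respects the relations: it is linear, and no two distinct indices
    exist for the alternating condition. *)
Lemma ext_power1_proj :
  exists h : {linear ext_power V 1 -> V}, forall x, h (ext_prod 1 [:: x]) = x.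
Proof.
have [|h hE] := ext_power_lift multilinear1.
  by move=> t i j; rewrite !ord1.
by exists h => x; rewrite (hE [tuple x]).
Qed.

Lemma sym_power1_proj :
  exists h : {linear sym_power V 1 -> V}, forall x, h (sym_prod 1 [:: x]) = x.
Proof.
have [|h hE] := sym_power_lift multilinear1.
  by move=> t s; rewrite tnth_mktuple ord1.
by exists h => x; rewrite (hE [tuple x]).
Qed.

(** With no slots both conditions on a function of tuples are vacuous, so the constant 1 descends.
    Hence the empty product is not zero. *)
Lemma ext_power0_proj :
  exists h : {linear ext_power V 0 -> K^o}, h (ext_prod 0 [::]) = 1.
Proof.
have [t []//|t []//|h hE] := @ext_power_lift K V K^o 0 (fun=> 1).
by exists h; rewrite (hE [tuple]).
Qed.

Lemma sym_power0_proj :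
  exists h : {linear sym_power V 0 -> K^o}, h (sym_prod 0 [::]) = 1.
Proof.
have [t []//|//|h hE] := @sym_power_lift K V K^o 0 (fun=> 1).
by exists h; rewrite (hE [tuple]).
Qed.

End LowPowers.

(** * The super exterior power in degree one *)

Section SuperExt1.
Variables (K : fieldType) (V : superspace K).

(** The identification of [V] with its first super exterior power. Since [wedge] takes homogeneous
    factors, [v] enters through its two components. *)
Definition wedge1 (v : V) : super_ext V 1 :=
  wedge 1 [:: inl v.1] + wedge 1 [:: inr v.2].

Lemma super_ext1_eq (x y : super_ext V 1) :
  x ord0 = y ord0 -> x ord_max = y ord_max -> x = y.
Proof.
move=> xy0 xy1; apply: functional_extensionality_dep => -[[|[|//]] lt_i].
  by rewrite (_ : Ordinal lt_i = ord0)//; exact: val_inj.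
by rewrite (_ : Ordinal lt_i = ord_max)//; exact: val_inj.
Qed.

(** The index of a summand counts even factors, so index 0 sees only the odd component; the even one
    fails the length test of [ext_prod 0] and yields 0. *)
Lemma wedge1_0 v : wedge1 v ord0 = tens (ext_prod 0 [::]) (sym_prod 1 [:: v.2]).
Proof.
(* A word with one letter has no crossing, so both signs compute to 1. *)
rewrite -[LHS]/(1 *: tens (ext_prod 0 [:: v.1]) (sym_prod 1 [::])
                + 1 *: tens (ext_prod 0 [::]) (sym_prod 1 [:: v.2])).
rewrite !scale1r -[RHS]add0r; congr (_ + _).
by rewrite /ext_prod insubF// (linear_fun0 (tens_linearl _)).
Qed.

Lemma wedge1_1 v :
  wedge1 v ord_max = tens (ext_prod 1 [:: v.1]) (sym_prod 0 [::]).
Proof.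
rewrite -[LHS]/(1 *: tens (ext_prod 1 [:: v.1]) (sym_prod 0 [::])
                + 1 *: tens (ext_prod 1 [::]) (sym_prod 0 [:: v.2])).
rewrite !scale1r -[RHS]addr0; congr (_ + _).
by rewrite /ext_prod insubF// (linear_fun0 (tens_linearl _)).
Qed.

Lemma wedge1_linear : linear wedge1.
Proof.
move=> a u v; apply: super_ext1_eq.
  rewrite -[RHS]/(a *: wedge1 u ord0 + wedge1 v ord0) !wedge1_0.
  by rewrite sym_prod1_linear tens_linearr.
rewrite -[RHS]/(a *: wedge1 u ord_max + wedge1 v ord_max) !wedge1_1.
by rewrite ext_prod1_linear tens_linearl.
Qed.

HB.instance Definition _ :=
  GRing.isLinear.Build K V (super_ext V 1) *:%R wedge1 wedge1_linear.

(** The component of the parity opposite to [a] is 0. The four cases are the two summands for each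
    parity of [a]: in the mixed ones both sides vanish, one by linearity and the other by the length
    test. *)
Lemma wedge1_elt (a : homog V) : wedge1 (elt a) = wedge 1 [:: a].
Proof.
apply: super_ext1_eq; rewrite ?wedge1_0 ?wedge1_1; case: a => x /=.
- rewrite -[RHS]/(1 *: tens (ext_prod 0 [:: x]) (sym_prod 1 [::])).
  rewrite scale1r /(ext_prod 0 [:: x]) insubF// (linear_fun0 (tens_linearl _)).
  rewrite (linear_fun0 (@sym_prod1_linear _ _)).
  by rewrite (linear_fun0 (tens_linearr _)).
- by rewrite -[LHS]scale1r.
- by rewrite -[LHS]scale1r.
- rewrite -[RHS]/(1 *: tens (ext_prod 1 [::]) (sym_prod 0 [:: x])).
  rewrite scale1r /(ext_prod 1 [::]) insubF// !(linear_fun0 (tens_linearl _)).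
  rewrite (linear_fun0 (@ext_prod1_linear _ _)).
  by rewrite (linear_fun0 (tens_linearl _)).
Qed.

(** In each summand one tensor factor is a power of exponent 0, spanned by the empty product. Its
    scalar moves across the tensor sign into the vector of the other factor. *)
Lemma wedge1_surj (x : super_ext V 1) : exists v, x = wedge1 v.
Proof.
have [y x0] : exists y, x ord0 = tens (ext_prod 0 [::]) (sym_prod 1 [:: y]).
  elim/freeg_lquot_ind: (x ord0) => [|a _ _ [y ->] [z ->]|[u w]].
  - exists 0; rewrite (linear_fun0 (@sym_prod1_linear _ _)).
    by rewrite (linear_fun0 (tens_linearr _)).
  - by exists (a *: y + z); rewrite sym_prod1_linear tens_linearr.
  - have [c uE] := ext_power0P u; have [y wE] := sym_power1P w.
    exists (c *: y); rewrite -/(tens u w) uE wE.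
    rewrite (linear_funZ _ _ (tens_linearl _)).
    rewrite (linear_funZ _ _ (@sym_prod1_linear _ _)).
    by rewrite (linear_funZ _ _ (tens_linearr _)).
have [z x1] : exists z, x ord_max = tens (ext_prod 1 [:: z]) (sym_prod 0 [::]).
  elim/freeg_lquot_ind: (x ord_max) => [|a _ _ [y' ->] [z ->]|[u w]].
  - exists 0; rewrite (linear_fun0 (@ext_prod1_linear _ _)).
    by rewrite (linear_fun0 (tens_linearl _)).
  - by exists (a *: y' + z); rewrite ext_prod1_linear tens_linearl.
  - have [z uE] := ext_power1P u; have [c wE] := sym_power0P w.
    exists (c *: z); rewrite -/(tens u w) uE wE.
    rewrite (linear_funZ _ _ (tens_linearr _)).
    rewrite (linear_funZ _ _ (@ext_prod1_linear _ _)).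
    by rewrite (linear_funZ _ _ (tens_linearl _)).
by exists (z, y); apply: super_ext1_eq; rewrite ?wedge1_0 ?wedge1_1.
Qed.

(** Together with [wedge1_surj] this makes [wedge1] an isomorphism. On each summand the inverse
    multiplies the vector from the exponent 1 factor by the scalar from the exponent 0 factor. *)
Lemma wedge1_retract :
  exists2 h : super_ext V 1 -> V, linear h & forall v, h (wedge1 v) = v.
Proof.
have [e0 e0E] := ext_power0_proj (even_part V).
have [e1 e1E] := ext_power1_proj (even_part V).
have [s0 s0E] := sym_power0_proj (odd_part V).
have [s1 s1E] := sym_power1_proj (odd_part V).
have [||h1 h1E] := tensor_lift (B := fun u w => (s0 w : K) *: e1 u).
- by move=> w a u u'; rewrite linearP scalerDr !scalerA mulrC.
- by move=> u a w w'; rewrite linearP scalerDl scalerA.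
have [||h0 h0E] := tensor_lift (B := fun u w => (e0 u : K) *: s1 w).
- by move=> w a u u'; rewrite linearP scalerDl scalerA.
- by move=> u a w w'; rewrite linearP scalerDr !scalerA mulrC.
(* The order is reversed: index 1 carries the even component and index 0 the odd one. *)
exists (fun x : super_ext V 1 => (h1 (x ord_max), h0 (x ord0))) => [a x y|v].
  rewrite -[(a *: x + y) ord_max]/(a *: x ord_max + y ord_max).
  by rewrite -[(a *: x + y) ord0]/(a *: x ord0 + y ord0) !linearP.
rewrite wedge1_0 wedge1_1 h0E h1E e0E e1E s0E s1E !scale1r.
by case: v.
Qed.

End SuperExt1.

(** * First cohomology with trivial coefficients *)

Section FirstCohomology.
Variables (K : fieldType) (g : lieSuperalgebra K).
Notation M := (trivial_module g).
Implicit Types f : cochain M 1.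

Lemma trivial_space_eq (m n : trivial_space K) : m.1 = n.1 -> m = n.
Proof.
case: m n => [m u] [n v] /= ->; congr pair.
by rewrite [u]thinmx0 [v]thinmx0.
Qed.

Lemma elt_split (x : g) : x = elt (inl x.1 : homog g) + elt (inr x.2 : homog g).
Proof.
case: x => u v /=; rewrite -[RHS]/(u + 0, 0 + v).
by rewrite addr0 add0r.
Qed.

Lemma elt_component (V : superspace K) e (v : V) :
  in_degree e v -> elt (component e v) = v.
Proof. by case: v => u v; case: e => /= ->. Qed.

(** [hbracket] keeps only the component of the expected parity; by [bracket_degree] the other one is
    0. *)
Lemma wedge_hbracket (a b : homog g) :
  wedge 1 [:: hbracket a b] = wedge1 (bracket (elt a) (elt b)).
Proof. by rewrite -wedge1_elt elt_component//; exact: bracket_degree. Qed.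

(** The action terms are 0, and (0, 1) is the only pair of indices with i < j. The parity [e] enters
    only through [tau], so it is absent from the right-hand side. *)
Lemma d_formula1 e f (w : 2.-tuple (homog g)) :
  d_formula e f w = (-1) ^+ sigma w ord0 ord_max *:
    f (wedge1 (bracket (elt (tnth w ord0)) (elt (tnth w ord_max)))).
Proof.
rewrite /d_formula big1 ?add0r; last by move=> i _; exact: scaler0.
rewrite (bigD1 ord0)//= (bigD1 ord_max)//= [X in _ + X + _]big1; last first.
  by case=> [[|[|]]].
rewrite [X in _ + X]big1 ?addr0; last first.
  by case=> [[|[|//]]]// ? _; apply: big1 => -[[|[|]]].
rewrite -wedge_hbracket; congr (_ *: f (wedge 1 (_ :: _))).
(* Omitting both indices leaves the empty list. *)
rewrite /omit; apply: size0nil.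
by rewrite size_map size_filter !enum_ordSl enum_ord0.
Qed.

(** The values lie in even degree, so the even and odd parts of [f] are its restrictions to the even
    and odd parts of [g], extended by 0. The retraction [h] carries the two projections of [g] over
    to the super exterior power. *)
Lemma cochain1_split f : exists f0 f1 : cochain M 1,
  [/\ cochain_degree false f0, cochain_degree true f1 & f = f0 + f1].
Proof.
have [h hl hE] := @wedge1_retract K g.
have fl (p : g -> g) : linear p -> linear (fun x => f (wedge1 (p (h x)))).
  by move=> pl a x y; rewrite hl pl wedge1_linear linearP.
have ev : linear (fun v : g => elt (inl v.1 : homog g)).
  by move=> a u v; congr pair; rewrite /= scaler0 addr0.
have od : linear (fun v : g => elt (inr v.2 : homog g)).
  by move=> a u v; congr pair; rewrite /= scaler0 addr0.
exists (linmap_of (fl _ ev)), (linmap_of (fl _ od)).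
have w1 (w : 1.-tuple (homog g)) : wedge 1 w = wedge1 (elt (tnth w ord0)).
  by rewrite wedge1_elt; case/tupleP: w => a w; rewrite [w]tuple0.
split.
- move=> w; rewrite big_ord1 w1 /= hE.
  case: (tnth w ord0) => x /=; first by rewrite [_.2]thinmx0.
  by rewrite !linear0.
- move=> w; rewrite big_ord1 w1 /= hE.
  case: (tnth w ord0) => x /=; last by rewrite [_.2]thinmx0.
  by rewrite !linear0.
- apply: linmap_eq => x; have [v ->] := wedge1_surj x.
  rewrite -[RHS]/(f (wedge1 _) + f (wedge1 _)) hE -linearD.
  by rewrite -(linearD (@wedge1 K g)) -elt_split.
Qed.

Lemma cochain1D f (u v : g) : f (wedge1 (u + v)) = f (wedge1 u) + f (wedge1 v).
Proof. by rewrite -[u]scale1r wedge1_linear linmap_linear !scale1r. Qed.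

(** The sign in [d_formula1] is the same for the even and the odd part of [f], so the two
    contributions recombine into [f], and the sign can be cancelled. *)
Lemma cocycle1P f :
  f \in @is_cocycle K g M 1 <-> forall x y, f (wedge1 (bracket x y)) = 0.
Proof.
have signK n (m : trivial_space K) : (-1) ^+ n *: m = 0 -> m = 0.
  by move=> m0; rewrite -[m]scale1r -(sqrr_sign _ n) expr2 -scalerA m0 scaler0.
split=> [/asboolP[f0 [f1 [_ _ -> df]]]|f0].
  have fE (a b : homog g) : (f0 + f1) (wedge1 (bracket (elt a) (elt b))) = 0.
    apply: (@signK (sigma [tuple a; b] ord0 ord_max)).
    have := df [tuple a; b]; rewrite !d_formula1 -scalerDr => /esym.
    exact.
  move=> x y; rewrite [x]elt_split [y]elt_split.
  have bl u u' v : bracket (u + u') v = bracket u v + bracket u' v :> g.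
    by rewrite -[u]scale1r bracket_linearl !scale1r.
  have br u v v' : bracket u (v + v') = bracket u v + bracket u v' :> g.
    by rewrite -[v]scale1r bracket_linearr !scale1r.
  (* Bilinearity breaks the bracket into four brackets of homogeneous elements. *)
  by rewrite !bl !br !cochain1D !fE !addr0.
apply/asboolP; have [f1 [f2 [df1 df2 fE]]] := cochain1_split f.
exists f1, f2; split=> // w; rewrite !d_formula1 -scalerDr.
have := f0 (elt (tnth w ord0)) (elt (tnth w ord_max)).
by rewrite fE => E; rewrite [X in _ *: X]E scaler0.
Qed.

(** On a single letter there is no pair i < j, so only the action term remains, and it is 0. Wedges
    of homogeneous elements then determine [z]. *)
Lemma coboundary1_eq0 (z : cocycle M 1) : @coboundaries K g M 1 z -> z = 0.
Proof.
move=> [h [h0 [h1 [_ _ _ dh]]]].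
apply: val_inj; apply: linmap_eq => x; have [v ->] := wedge1_surj x.
have zE (a : homog g) : cocycle_val z (wedge1 (elt a)) = 0.
  have d0 e (f : cochain M 0) : d_formula e f [tuple a] = 0.
    rewrite /d_formula !big_ord1 [X in _ *: X](_ : _ = 0)// scaler0 add0r.
    by rewrite big_pred0// => -[[]].
  by rewrite wedge1_elt (dh [tuple a]) !d0 addr0.
by rewrite [v]elt_split cochain1D !zE addr0.
Qed.

Lemma abelianization_dual_eq (psi psi' : abelianization_dual g) :
  (forall v, psi (lquot_pi (@brackets K g) v) =
             psi' (lquot_pi (@brackets K g) v)) -> psi = psi'.
Proof. by move=> E; apply: linmap_eq; elim/lquot_piW. Qed.

Lemma cocycle_dual : exists Psi : {linear cocycle M 1 -> abelianization_dual g},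
  forall z v, Psi z (lquot_pi (@brackets K g) v) = (cocycle_val z (wedge1 v)).1.
Proof.
(* Each functional is only known to exist, hence the choice. Linearity of [Psi] follows because the
   values on classes determine a functional. *)
have /choice[Psi PsiE] (z : cocycle M 1) : exists psi : abelianization_dual g,
    forall v, psi (lquot_pi (@brackets K g) v) = (cocycle_val z (wedge1 v)).1.
  pose F (v : g) : K^o := (cocycle_val z (wedge1 v)).1.
  have Fl : linear F.
    by move=> a u v; rewrite /F wedge1_linear linmap_linear.
  pose FL := GRing.isLinear.Build K g K^o *:%R F Fl.
  have [|h hE] := @lquot_lift K g K^o (@brackets K g)
    (HB.pack_for {linear g -> K^o} F FL).
    move=> _ [x [y ->]]; rewrite /= /F.
    by have /cocycle1P -> := cocycle_valP z.
  by exists (linmap_of (linearP h)) => v; rewrite /= hE.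
have Psil : linear Psi.
  move=> a z z'; apply: abelianization_dual_eq => v.
  by rewrite PsiE -[RHS]/(a *: Psi z _ + Psi z' _) !PsiE.
pose PsiL := GRing.isLinear.Build K _ _ *:%R Psi Psil.
by exists (HB.pack_for {linear cocycle M 1 -> abelianization_dual g} Psi PsiL).
Qed.

Theorem first_cohomology :
  exists phi : {linear cohomology M 1 -> abelianization_dual g},
    bijective phi /\
    forall (e : bool) (c : cohomology M 1),
      cohomology_degree e c <-> dual_degree e (phi c).
Proof.
have [Psi PsiE] := cocycle_dual.
have [|phi phiE] := @lquot_lift K _ _ (@coboundaries K g M 1) Psi.
  by move=> z /coboundary1_eq0 ->; rewrite linear0.
exists phi; split=> [|e c]; last split.
- have /choice[inv invK] psi : exists c, phi c = psi.
    have [h hl hE] := @wedge1_retract K g.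
    (* The preimage of [psi] is its pullback to [g], moved to the super exterior power by [h] and
       placed in the even coordinate of the trivial module. *)
    have fl : linear (fun x => (psi (lquot_pi _ (h x)), 0) : trivial_space K).
      move=> a x y; apply: trivial_space_eq.
      by rewrite hl linearP linmap_linear.
    have fz : linmap_of fl \in @is_cocycle K g M 1.
      apply/cocycle1P => x y /=; rewrite hE lquot_pi0 ?linear0//.
      by exists x, y.
    exists (lquot_pi _ (Cocycle fz)); rewrite phiE.
    by apply: abelianization_dual_eq => v; rewrite PsiE /= hE.
  exists inv => // c.
  have phi_inj : injective phi.
    apply: raddf_inj; elim/lquot_piW => z z0.
    have {}z0 : Psi z = 0 by rewrite -phiE.
    rewrite (_ : z = 0) ?linear0//; apply: val_inj; apply: linmap_eq => x.
    have [v ->] := wedge1_surj x; apply: trivial_space_eq.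
    by rewrite -PsiE z0.
  by apply: phi_inj; rewrite invK.
(* If the parity of [a] is not [e], the value of [z] on [a] must be odd, so its even coordinate is
   0. *)
- move=> [z [dz ->]] a ae; rewrite phiE PsiE wedge1_elt.
  have := dz [tuple a]; rewrite big_ord1 /=.
  by move: ae; case: e {dz}; case: a.
(* Any representative [z] will do. Where its value must be even, the odd coordinate vanishes because
   it lies in a space of dimension 0; where it must be odd, [dz] applies. *)
elim/lquot_piW: c => z; rewrite phiE => dz; exists z; split=> // w.
rewrite big_ord1; case/tupleP: w => a w; rewrite [w]tuple0.
have := dz a; rewrite PsiE wedge1_elt.
rewrite /in_degree; case: ifP => [ea -> //|_ _]; last by rewrite [_.2]thinmx0.
by move: ea; case: e {dz}; case: a.
Qed.

End FirstCohomology.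

Theorem theorem4p1p1 (R : realType) (g : lieSuperalgebra R[i]) :
  exists phi : {linear cohomology (trivial_module g) 1 -> abelianization_dual g},
    bijective phi /\
    forall (e : bool) (c : cohomology (trivial_module g) 1),
      cohomology_degree e c <-> dual_degree e (phi c).
Proof. exact: first_cohomology. Qed.
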